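(* Let $A$ be an $n\times n$ real symmetric matrix with characteristic polynomial $\det(\lambda I-A)=\lambda^n+c_1\lambda^{n-1}+\cdots+c_n$ and singular values $\sigma_1\ge\cdots\ge\sigma_n$, and let $1\le k\le n$. Let $T$ be a real symmetric tridiagonal matrix orthogonally similar to $A$, and let $\tilde T=T+E$ be the symmetric tridiagonal matrix computed in floating point arithmetic by applying Householder similarity transformations to $A$, where $\|E\|_F\le \nu_1 n^2\|A\|_F\,u$ for a constant $\nu_1>0$. Assume the floating point assumptions stated in the context and that $\|A\|_F<1/(\nu_1 n^2u)$. Let $\tilde c_j$ be the coefficients of the characteristic polynomial $\det(\lambda I-\tilde T)=\lambda^n+\tilde c_1\lambda^{n-1}+\cdots+\tilde c_n$, let $\mathrm{fl}[\tilde c_j]$ be the coefficients computed by applying La Budde's method for symmetric tridiagonal matrices (recursion in the context) to $\tilde T$ in floating point arithmetic, and let $\phi_j$ be the corresponding running error bounds defined in the context. Then $$|\mathrm{fl}[\tilde{c}_j]-c_j|\leq (n-j+1)\,s_{j-1}\, \nu_1 n^2\|A\|_F\,u+\phi_j+\mathcal{O}\left(u^2\right),\qquad 1\leq j\leq k,$$ where $s_0=1$ and $s_j=\sum_{1\leq i_1<\cdots<i_j\leq n}\sigma_{i_1}\cdots \sigma_{i_j}$ is the $j$th elementary symmetric function of all $n$ singular values of $A$.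
   Context: This is a first order bound: $\mathcal O(u^2)$ refers to $u\to0$ with $A$, $n$, $\nu_1$ fixed. $\|\cdot\|_F$ is the Frobenius norm. Floating point assumptions: all matrix elements are normalized real floating point numbers; $u$ is the unit roundoff and $nu<1$; no operation underflows or overflows; $\mathrm{fl}[\cdot]$ denotes the result computed in floating point arithmetic (a product of three numbers such as $\beta_i^2\hat c$ is computed by two successive floating point multiplications). For $\mathrm{op}\in\{+,-,\times,/\}$ and normalized real floating point numbers $x,y$ such that $x\ \mathrm{op}\ y$ does not underflow or overflow, $\mathrm{fl}[x\ \mathrm{op}\ y]=(x\ \mathrm{op}\ y)(1+\delta)$ for some $|\delta|\le u$, and also $\mathrm{fl}[x\ \mathrm{op}\ y]=(x\ \mathrm{op}\ y)/(1+\epsilon)$ for some $|\epsilon|\le u$. $\gamma_m=\frac{mu}{1-mu}$. Let $\alpha_1,\ldots,\alpha_n$ be the diagonal elements and $\beta_2,\ldots,\beta_n$ the off-diagonal elements of $\tilde T$ ($\beta_i$ in positions $(i-1,i)$ and $(i,i-1)$). Computed recursion (for $j\le k$): $\hat c_1^{(1)}=-\alpha_1$ (exact); $\hat{c}_1^{(i)}=\mathrm{fl}[\hat{c}_1^{(i-1)}-\alpha_i]$ for $2\le i\le n$; $\hat c_2^{(2)}=\mathrm{fl}[\mathrm{fl}[\alpha_1\alpha_2]-\mathrm{fl}[\beta_2^2]]$; $\hat c_2^{(i)}=\mathrm{fl}[\mathrm{fl}[\hat c_2^{(i-1)}-\mathrm{fl}[\alpha_i\hat c_1^{(i-1)}]]-\mathrm{fl}[\beta_i^2]]$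 for $3\le i\le n$; $\hat c_i^{(i)}=-\mathrm{fl}[\mathrm{fl}[\alpha_i\hat c_{i-1}^{(i-1)}]+\mathrm{fl}[\beta_i^2\hat c_{i-2}^{(i-2)}]]$ for $3\le i\le k$; $\hat c_j^{(i)}=\mathrm{fl}[\mathrm{fl}[\hat{c}_j^{(i-1)}-\mathrm{fl}[\alpha_i\hat c_{j-1}^{(i-1)}]]-\mathrm{fl}[\beta_i^2\hat c_{j-2}^{(i-2)}]]$ for $3\le j\le k$, $j+1\le i\le n$. The output is $\mathrm{fl}[\tilde c_j]=\hat c_j^{(n)}$, $1\le j\le k$. Running error bounds: define nonnegative numbers $\phi_j^{(i)}$ by $\phi_1^{(1)}=0$; $\phi_1^{(i)}=\phi_1^{(i-1)}+u|\hat c_1^{(i)}|$ for $2\le i\le n$; $\phi_2^{(2)}=u(|\alpha_2\alpha_1|+|\beta_2^2|+|\hat c_2^{(2)}|)$; $\phi_2^{(i)}=\phi_2^{(i-1)}+|\alpha_i|\phi_1^{(i-1)}+u(|\hat c_2^{(i-1)}|+|\beta_i^2|+|\hat c_2^{(i)}|)+\gamma_2|\alpha_i\hat c_1^{(i-1)}|$ for $3\le i\le n$; $\phi_i^{(i)}=|\alpha_i|\phi_{i-1}^{(i-1)}+\beta_i^2\phi_{i-2}^{(i-2)}+u(|\alpha_i\hat c_{i-1}^{(i-1)}|+|\hat c_i^{(i)}|)+\gamma_2|\beta_i^2\hat c_{i-2}^{(i-2)}|$ for $3\le i\le k$; $\phi_j^{(i)}=\phi_j^{(i-1)}+|\alpha_i|\phi_{j-1}^{(i-1)}+\beta_i^2\phi_{j-2}^{(i-2)}+u(|\hat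 c_j^{(i-1)}|+|\hat c_j^{(i)}|)+\gamma_2(|\alpha_i\hat c_{j-1}^{(i-1)}|+|\beta_i^2\hat c_{j-2}^{(i-2)}|)$ for $3\le j\le k$, $j+1\le i\le n$. Finally $\phi_j=\phi_j^{(n)}$ for $1\le j\le k$. *)

(* Defs.v *)
From HB Require Import structures.
From mathcomp Require Import all_boot all_order all_algebra.
From mathcomp Require Import all_classical all_reals all_analysis.

Set Implicit Arguments.
Unset Strict Implicit.
Unset Printing Implicit Defensive.

Import Order.TTheory GRing.Theory Num.Theory.
Import numFieldNormedType.Exports.

Local Open Scope ring_scope.

(** * Matrices *)

Definition frobenius_norm (R : realType) (m n : nat) (A : 'M[R]_(m, n)) : R :=
  Num.sqrt (\sum_(i < m) \sum_(j < n) A i j ^+ 2).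

Definition symmetric_mx (R : realType) (n : nat) (A : 'M[R]_n) : Prop :=
  A^T = A.

Definition orthogonal_mx (R : realType) (n : nat) (Q : 'M[R]_n) : Prop :=
  Q^T *m Q = 1%:M.

Definition orthogonally_similar (R : realType) (n : nat) (A B : 'M[R]_n) :
    Prop :=
  exists2 Q : 'M[R]_n, orthogonal_mx Q & B = Q^T *m A *m Q.

Definition tridiagonal_mx (R : realType) (n : nat) (A : 'M[R]_n) : Prop :=
  forall i j : 'I_n, (i.+1 < j)%N || (j.+1 < i)%N -> A i j = 0.

(* [c_j], where det(x I - A) = x^n + c_1 x^(n-1) + ... + c_n; to be used for
   [j <= n] only. *)
Definition char_coef (R : realType) (n : nat) (A : 'M[R]_n) (j : nat) : R :=
  (char_poly A)`_(n - j).

(* The singular values are the nonnegative square roots of the eigenvalues of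
   [A^T *m A], counted with multiplicity and listed in nonincreasing order. *)
Definition singular_values (R : realType) (n : nat) (A : 'M[R]_n)
    (sigma : 'I_n -> R) : Prop :=
  [/\ forall i, 0 <= sigma i,
      forall i j : 'I_n, (i <= j)%N -> sigma j <= sigma i &
      char_poly (A^T *m A) = \prod_(i < n) ('X - (sigma i ^+ 2)%:P)].

Definition elem_sym (R : realType) (n : nat) (sigma : 'I_n -> R) (j : nat) :
    R :=
  \sum_(I : {set 'I_n} | #|I| == j) \prod_(i in I) sigma i.

(* Subscripts are 1-based, matrix indices 0-based: the diagonal is
   [alpha 1, ..., alpha n] and [beta i], for [2 <= i <= n], is in the 1-based
   positions [(i-1, i)] and [(i, i-1)]; [alpha 0], [beta 0] and [beta 1] are
   not used. *)
Definition symtridiag_mx (R : realType) (n : nat) (alpha beta : nat -> R) :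
    'M[R]_n :=
  \matrix_(i < n, j < n)
    if i == j then alpha i.+1
    else if j == i.+1 :> nat then beta j.+1
    else if i == j.+1 :> nat then beta i.+1
    else 0.

(** * Floating point arithmetic *)

Inductive fpop := FpAdd | FpSub | FpMul | FpDiv.

Definition exact_op (R : realType) (op : fpop) (x y : R) : R :=
  match op with
  | FpAdd => x + y
  | FpSub => x - y
  | FpMul => x * y
  | FpDiv => x / y
  end.

(* [fpnum] is the set of normalized real floating point numbers (a system in
   which zero is representable has [fpnum 0]); [fl_op op x y] is the computed
   result of [x op y], and [None] if the operation is exceptional (underflow,
   overflow or division by zero). *)
Record fparith (R : realType) := FPArith {
  fpnum : R -> Prop;
  fl_op : fpop -> R -> R -> option R
}.

(* The rounding error model with unit roundoff [u].  The sign change is exact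
   and is not one of the rounded operations. *)
Definition fp_model (R : realType) (u : R) (fp : fparith R) : Prop :=
  (forall x, fpnum fp x -> fpnum fp (- x)) /\
  (forall op x y z, fpnum fp x -> fpnum fp y -> fl_op fp op x y = Some z ->
     [/\ fpnum fp z,
         exists2 delta, `|delta| <= u & z = exact_op op x y * (1 + delta) &
         exists2 eps, `|eps| <= u & z = exact_op op x y / (1 + eps)]).

Inductive fpexpr (R : Type) :=
  | FpNum of R
  | FpNeg of fpexpr R
  | FpOp of fpop & fpexpr R & fpexpr R.

(* The value computed for an expression when every operation in it is rounded;
   [None] if one of these operations is exceptional. *)
Fixpoint fl_eval (R : realType) (fp : fparith R) (e : fpexpr R) : option R :=
  match e with
  | FpNum x => Some x
  | FpNeg e1 => if fl_eval fp e1 is Some x then Some (- x) else None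
  | FpOp op e1 e2 =>
      match fl_eval fp e1, fl_eval fp e2 with
      | Some x, Some y => fl_op fp op x y
      | _, _ => None
      end
  end.

Declare Scope fpexpr_scope.
Delimit Scope fpexpr_scope with fpexpr.
Notation "- e" := (FpNeg e) : fpexpr_scope.
Notation "e1 + e2" := (FpOp FpAdd e1 e2) : fpexpr_scope.
Notation "e1 - e2" := (FpOp FpSub e1 e2) : fpexpr_scope.
Notation "e1 * e2" := (FpOp FpMul e1 e2) : fpexpr_scope.

Definition gamma_ (R : realType) (m : nat) (u : R) : R :=
  (m%:R * u) / (1 - m%:R * u).

(** * La Budde's method for symmetric tridiagonal matrices *)

(* The expression evaluated for the coefficient with subscript [j] and
   superscript [i]; [c j' i'] is the computed coefficient with subscript [j']
   and superscript [i'].  The parentheses fix the order of the operations, in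
   particular [beta_i ^ 2 * c] is [(beta_i * beta_i) * c]. *)
Definition labudde_expr (R : realType) (alpha beta : nat -> R)
    (c : nat -> nat -> R) (j i : nat) : fpexpr R :=
  let a k := FpNum (alpha k) in
  let b k := FpNum (beta k) in
  let C j i := FpNum (c j i) in
  (if j == 1%N then
     if i == 1%N then - a 1%N
     else C 1%N i.-1 - a i
   else if j == 2%N then
     if i == 2%N then a 1%N * a 2%N - b 2%N * b 2%N
     else (C 2%N i.-1 - a i * C 1%N i.-1) - b i * b i
   else
     if i == j then - (a i * C i.-1 i.-1 + (b i * b i) * C i.-2 i.-2)
     else (C j i.-1 - a i * C j.-1 i.-1) - (b i * b i) * C j.-2 i.-2)%fpexpr.

(* [c j i], for [1 <= j <= k] and [j <= i <= n], are the results of the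
   recursion in floating point arithmetic, in which no operation is
   exceptional. *)
Definition labudde_computed (R : realType) (fp : fparith R) (n k : nat)
    (alpha beta : nat -> R) (c : nat -> nat -> R) : Prop :=
  forall j i, (1 <= j <= k)%N -> (j <= i <= n)%N ->
    fl_eval fp (labudde_expr alpha beta c j i) = Some (c j i).

Definition running_bound_rhs (R : realType) (u : R) (alpha beta : nat -> R)
    (c phi : nat -> nat -> R) (j i : nat) : R :=
  if j == 1%N then
    if i == 1%N then 0
    else phi 1%N i.-1 + u * `|c 1%N i|
  else if j == 2%N then
    if i == 2%N then
      u * (`|alpha 2%N * alpha 1%N| + `|beta 2%N ^+ 2| + `|c 2%N 2%N|)
    else
      phi 2%N i.-1 + `|alpha i| * phi 1%N i.-1
      + u * (`|c 2%N i.-1| + `|beta i ^+ 2| + `|c 2%N i|)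
      + gamma_ 2 u * `|alpha i * c 1%N i.-1|
  else
    if i == j then
      `|alpha i| * phi i.-1 i.-1 + beta i ^+ 2 * phi i.-2 i.-2
      + u * (`|alpha i * c i.-1 i.-1| + `|c i i|)
      + gamma_ 2 u * `|beta i ^+ 2 * c i.-2 i.-2|
    else
      phi j i.-1 + `|alpha i| * phi j.-1 i.-1 + beta i ^+ 2 * phi j.-2 i.-2
      + u * (`|c j i.-1| + `|c j i|)
      + gamma_ 2 u * (`|alpha i * c j.-1 i.-1| + `|beta i ^+ 2 * c j.-2 i.-2|).

Definition running_bounds (R : realType) (u : R) (n k : nat)
    (alpha beta : nat -> R) (c phi : nat -> nat -> R) : Prop :=
  forall j i, (1 <= j <= k)%N -> (j <= i <= n)%N ->
    phi j i = running_bound_rhs u alpha beta c phi j i.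

(* Main.v *)
Require Import Defs.
From HB Require Import structures.
From mathcomp Require Import all_boot all_order all_algebra.
From mathcomp Require Import all_classical all_reals all_analysis.
From mathcomp Require Import fingroup perm spectral complex.
From mathcomp Require Import ring lra zify.
Import Order.TTheory GRing.Theory Num.Theory.
Import numFieldNormedType.Exports.
Local Open Scope ring_scope.

(** The error splits into a rounding and a perturbation part.

    Rounding: the leading principal submatrices of a symmetric tridiagonal
    matrix have characteristic polynomials obeying a three-term recurrence,
    which the algorithm follows.  Writing the last rounding of each step in the
    form [z (1 + eps) = x op y] bounds its error by [u |z|], and induction gives
    [|fl(c_j) - c_j(T + E)| <= phi_j] without any second order term.

    Perturbation: with [A = P^-1 D P], [P] unitary over [R[i]], the matrix
    [T + E] is unitarily similar to [D + F], where [D] depends on [A] only and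
    [|F i j| <= ||E||_F].  In the Leibniz formula for [det (X - D - F)] the part
    that is linear in [F] is [- sum_i F_ii prod_(l != i) (X - d_l)]; its
    coefficients are at most [||E||_F] times those of the derivative of
    [prod_l (X + |d_l|) = prod_l (X + sigma_l)], namely
    [(n - j + 1) s_(j-1)] for the power [X^(n-j)].  The rest is
    [O(||E||_F^2)], uniformly in [T] and [E]. *)

(** * Running error bound *)

Lemma cofactor_ord_max (R : comNzRingType) (n : nat) (M : 'M[R]_n.+1) :
  cofactor M ord_max ord_max =
  \det (\matrix_(i < n, j < n) M (widen_ord (leqnSn n) i) (widen_ord (leqnSn n) j)).
Proof.
rewrite /cofactor -signr_odd addnn odd_double expr0 mul1r; congr (\det _).
by apply/matrixP => i j; rewrite !mxE; congr (M _ _); apply: val_inj;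
  rewrite /= /bump leqNgt ltn_ord.
Qed.

(* Expansion along the last row: only its last two entries are nonzero. *)
Lemma char_poly_symtridiag (R : realType) (alpha beta : nat -> R) (n : nat) :
  char_poly (symtridiag_mx n.+2 alpha beta) =
  ('X - (alpha n.+2)%:P) * char_poly (symtridiag_mx n.+1 alpha beta)
  - (beta n.+2 ^+ 2)%:P * char_poly (symtridiag_mx n alpha beta).
Proof.
rewrite {1}/char_poly (expand_det_row _ ord_max) big_ord_recr big_ord_recr /=.
rewrite big1 ?add0r; last first.
  move=> i _; rewrite !mxE -!val_eqE /=.
  have := ltn_ord i => ltin.
  have -> : (n.+1 == i)%N = false by lia.
  by rewrite !ifF ?mulr0n ?subr0 ?mul0r //; lia.
rewrite addrC; congr (_ + _).
  rewrite cofactor_ord_max !mxE eqxx; congr (_ * \det _).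
  by apply/matrixP => i j; rewrite !mxE -!val_eqE.
set k := widen_ord _ _.
rewrite !mxE -!val_eqE /= eqn_leq ltnn /= mulr0n sub0r.
rewrite [(n == n.+2)%N]ltn_eqF ?eqxx; last by lia.
rewrite /cofactor /= -signr_odd addSn addnn /= odd_double expr1 mulNr mul1r mulrNN.
rewrite (expand_det_col _ ord_max) big_ord_recr /= big1 ?add0r; last first.
  move=> i _; rewrite !mxE -!val_eqE /=.
  have lti := ltn_ord i.
  have -> : bump n.+1 i = i by rewrite /bump; lia.
  have -> : bump n n = n.+1 by rewrite /bump; lia.
  have -> : (i == n.+1 :> nat)%N = false by lia.
  by rewrite !ifF ?mulr0n ?subr0 ?mul0r //; lia.
rewrite cofactor_ord_max mulrA expr2 rmorphM /= -mulNr.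
congr (_ * _).
  rewrite !mxE -!val_eqE /=.
  have -> : bump n.+1 n = n by rewrite /bump; lia.
  have -> : bump n n = n.+1 by rewrite /bump; lia.
  by rewrite [(n == n.+1)%N]ltn_eqF // eqxx mulr0n sub0r mulrN.
congr (\det _); apply/matrixP => i j; rewrite !mxE -!val_eqE /=.
have [lti ltj] := (ltn_ord i, ltn_ord j).
have -> : bump n.+1 i = i by rewrite /bump; lia.
by have -> : bump n j = j by rewrite /bump; lia.
Qed.

(** The leading coefficient serves as c_0 = 1, which closes the recurrence for the subscripts 1 and
    2. *)
Lemma char_coef0 (R : realType) (n : nat) (M : 'M[R]_n) : char_coef M 0 = 1.
Proof.
rewrite /char_coef subn0; have /monicP := char_poly_monic M.
by rewrite lead_coefE size_char_poly.
Qed.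

Lemma char_coef_symtridiag1 (R : realType) (alpha beta : nat -> R) :
  char_coef (symtridiag_mx 1 alpha beta) 1 = - alpha 1%N.
Proof.
by rewrite /char_coef subnn char_poly_det det_mx11 !mxE /= expr1 mulN1r.
Qed.

Lemma char_coef_symtridiag_1S (R : realType) (alpha beta : nat -> R) (n : nat) :
  char_coef (symtridiag_mx n.+2 alpha beta) 1 =
  char_coef (symtridiag_mx n.+1 alpha beta) 1 - alpha n.+2.
Proof.
rewrite -[in RHS](mulr1 (alpha _)).
rewrite -[in RHS](char_coef0 _ _ (symtridiag_mx n.+1 alpha beta)).
rewrite /char_coef char_poly_symtridiag mulrBl !coefB coefXM !coefCM /= subn0.
(* The [beta] term has degree [n] only, so it does not reach the coefficient of X^(n+1). *)
rewrite !subSS !subn0 /= [X in _ - _ * X]nth_default ?mulr0 ?subr0 //.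
by rewrite size_char_poly.
Qed.

Lemma char_coef_symtridiag_diag (R : realType) (alpha beta : nat -> R) (n : nat) :
  char_coef (symtridiag_mx n.+2 alpha beta) n.+2 =
  - (alpha n.+2 * char_coef (symtridiag_mx n.+1 alpha beta) n.+1
     + beta n.+2 ^+ 2 * char_coef (symtridiag_mx n alpha beta) n).
Proof.
rewrite /char_coef char_poly_symtridiag mulrBl !coefB coefXM !coefCM !subnn /=.
by rewrite sub0r opprD.
Qed.

(** By [j < n] the coefficient read off, that of X^(n-j), is not the constant one, so the product
    with X contributes. At the constant coefficient that product vanishes, which is the diagonal
    case above. *)
Lemma char_coef_symtridiag_rec (R : realType) (alpha beta : nat -> R) (n j : nat) :
  (j < n)%N ->
  char_coef (symtridiag_mx n.+2 alpha beta) j.+2 =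
  char_coef (symtridiag_mx n.+1 alpha beta) j.+2
  - alpha n.+2 * char_coef (symtridiag_mx n.+1 alpha beta) j.+1
  - beta n.+2 ^+ 2 * char_coef (symtridiag_mx n alpha beta) j.
Proof.
move=> ltjn.
rewrite /char_coef char_poly_symtridiag mulrBl !coefB coefXM !coefCM.
rewrite !subSS subn_eq0 leqNgt ltjn /=.
by rewrite -subnS.
Qed.

(** * Rounding errors of the individual recursion steps *)

(** Two roundings give the relative error d1 + d2 + d1 d2, at most 2u + u^2, and (2u + u^2)(1 - 2u)
    <= 2u. The constant is [gamma_ 2 u]. *)
Lemma rounded_product_error (R : realFieldType) (u x d1 d2 : R) :
  0 < u -> 2%:R * u < 1 -> `|d1| <= u -> `|d2| <= u ->
  `|x * ((1 + d1) * (1 + d2)) - x| <= (2%:R * u) / (1 - 2%:R * u) * `|x|.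
Proof.
move=> u0 u1 h1 h2.
have -> : x * ((1 + d1) * (1 + d2)) - x = (d1 + d2 + d1 * d2) * x by ring.
rewrite normrM ler_wpM2r ?normr_ge0 //.
have hp : `|d1 * d2| <= u * u by rewrite normrM ler_pM.
have h3 : `|d1 + d2 + d1 * d2| <= u + u + u * u.
  by rewrite (le_trans (ler_normD _ _)) // lerD // (le_trans (ler_normD _ _)) // lerD.
apply: le_trans h3 _; rewrite ler_pdivlMr; last lra.
nra.
Qed.

Section RunningError.
Variables (R : realType) (u : R) (fp : fparith R).
Hypothesis hfp : fp_model u fp.

Lemma fl_op_delta (op : fpop) (x y z : R) :
  fpnum fp x -> fpnum fp y -> fl_op fp op x y = Some z ->
  fpnum fp z /\ exists2 d, `|d| <= u & z = exact_op op x y * (1 + d).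
Proof. by move=> hx hy /(hfp.2 _ _ _ _ hx hy)[]. Qed.

(** With z (1 + eps) = x op y the error is - eps z, hence bounded by the computed value itself; this
    is what makes a running bound possible. *)
Lemma fl_op_eps (op : fpop) (x y z : R) :
  u < 1 -> fpnum fp x -> fpnum fp y -> fl_op fp op x y = Some z ->
  fpnum fp z /\ `|z - exact_op op x y| <= u * `|z|.
Proof.
move=> u1 hx hy /(hfp.2 _ _ _ _ hx hy)[fz _ [e he zE]]; split=> //.
have e1 : 1 + e != 0.
  by rewrite gt_eqF //; move: he; rewrite ler_norml => /andP[]; lra.
have -> : z - exact_op op x y = - (e * z).
  have -> : exact_op op x y = z * (1 + e) by rewrite zE mulfVK.
  ring.
by rewrite normrN normrM ler_wpM2r.
Qed.

(** The rounding of the inner subtraction acts on [c1] and on the already rounded product [a * c2];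
    so [c1] is charged u and both products are charged [gamma_ 2 u]. The outer subtraction is
    charged u times its result. *)
Lemma fl_cancel_step (c1 a c2 b c3 z : R) :
  0 < u -> 2%:R * u < 1 ->
  fpnum fp c1 -> fpnum fp a -> fpnum fp c2 -> fpnum fp b -> fpnum fp c3 ->
  fl_eval fp ((FpNum c1 - FpNum a * FpNum c2)
              - (FpNum b * FpNum b) * FpNum c3)%fpexpr = Some z ->
  fpnum fp z /\
  `|z - (c1 - a * c2 - b ^+ 2 * c3)| <=
    u * (`|c1| + `|z|) + gamma_ 2 u * (`|a * c2| + `|b ^+ 2 * c3|).
Proof.
move=> u0 u2 f1 fa f2 fb f3 /=.
case E1 : (fl_op fp FpMul a c2) => [p|] //.
case E2 : (fl_op fp FpSub c1 p) => [y|] //.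
case E3 : (fl_op fp FpMul b b) => [q|] //.
case E4 : (fl_op fp FpMul q c3) => [r|] // E5.
have [fp_ [d1 h1 /= pE]] := fl_op_delta _ _ _ _ fa f2 E1.
have [fy [d2 h2 /= yE]] := fl_op_delta _ _ _ _ f1 fp_ E2.
have [fq [d3 h3 /= qE]] := fl_op_delta _ _ _ _ fb fb E3.
have [fr [d4 h4 /= rE]] := fl_op_delta _ _ _ _ fq f3 E4.
have [|fz /= hz] := fl_op_eps _ _ _ _ _ fy fr E5; first lra.
split=> //.
have k1 := rounded_product_error _ u (a * c2) d1 d2 u0 u2 h1 h2.
have k2 := rounded_product_error _ u (b ^+ 2 * c3) d3 d4 u0 u2 h3 h4.
have k3 : `|c1 * d2| <= u * `|c1| by rewrite normrM mulrC ler_wpM2r.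
rewrite -!/(gamma_ 2 u) in k1 k2.
set A1 := (a * c2 * _ - _) in k1; set B1 := (b ^+ 2 * c3 * _ - _) in k2.
have -> : z - (c1 - a * c2 - b ^+ 2 * c3) = (z - (y - r)) + c1 * d2 - A1 - B1.
  by rewrite yE rE pE qE /A1 /B1; ring.
rewrite (le_trans (ler_normB _ _)) // mulrDr mulrDr.
have := ler_normB (z - (y - r) + c1 * d2) A1.
have := ler_normD (z - (y - r)) (c1 * d2).
lra.
Qed.

(** Here [b ^+ 2] is not multiplied further, so it carries a single rounding and is charged u
    instead of [gamma_ 2 u]. *)
Lemma fl_cancel_step2 (c1 a c2 b z : R) :
  0 < u -> 2%:R * u < 1 ->
  fpnum fp c1 -> fpnum fp a -> fpnum fp c2 -> fpnum fp b ->
  fl_eval fp ((FpNum c1 - FpNum a * FpNum c2)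
              - FpNum b * FpNum b)%fpexpr = Some z ->
  fpnum fp z /\
  `|z - (c1 - a * c2 - b ^+ 2)| <=
    u * (`|c1| + `|b ^+ 2| + `|z|) + gamma_ 2 u * `|a * c2|.
Proof.
move=> u0 u2 f1 fa f2 fb /=.
case E1 : (fl_op fp FpMul a c2) => [p|] //.
case E2 : (fl_op fp FpSub c1 p) => [y|] //.
case E3 : (fl_op fp FpMul b b) => [q|] // E5.
have [fp_ [d1 h1 /= pE]] := fl_op_delta _ _ _ _ fa f2 E1.
have [fy [d2 h2 /= yE]] := fl_op_delta _ _ _ _ f1 fp_ E2.
have [fq [d3 h3 /= qE]] := fl_op_delta _ _ _ _ fb fb E3.
have [|fz /= hz] := fl_op_eps _ _ _ _ _ fy fq E5; first lra.
split=> //.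
have k1 := rounded_product_error _ u (a * c2) d1 d2 u0 u2 h1 h2.
have k2 : `|b ^+ 2 * d3| <= u * `|b ^+ 2|.
  by rewrite normrM mulrC ler_wpM2r.
have k3 : `|c1 * d2| <= u * `|c1| by rewrite normrM mulrC ler_wpM2r.
rewrite -!/(gamma_ 2 u) in k1.
set A1 := (a * c2 * _ - _) in k1; set B1 := (b ^+ 2 * _) in k2.
have -> : z - (c1 - a * c2 - b ^+ 2) = (z - (y - q)) + c1 * d2 - A1 - B1.
  by rewrite yE pE qE /A1 /B1; ring.
rewrite (le_trans (ler_normB _ _)) // !mulrDr.
have := ler_normB (z - (y - q) + c1 * d2) A1.
have := ler_normD (z - (y - q)) (c1 * d2).
lra.
Qed.

Lemma fl_diag_step2 (a1 a2 b z : R) :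
  u < 1 -> fpnum fp a1 -> fpnum fp a2 -> fpnum fp b ->
  fl_eval fp (FpNum a1 * FpNum a2 - FpNum b * FpNum b)%fpexpr = Some z ->
  fpnum fp z /\
  `|z - (a1 * a2 - b ^+ 2)| <= u * (`|a2 * a1| + `|b ^+ 2| + `|z|).
Proof.
move=> u1 f1 f2 fb /=.
case E1 : (fl_op fp FpMul a1 a2) => [p|] //.
case E2 : (fl_op fp FpMul b b) => [q|] // E3.
have [fp_ [d1 h1 /= pE]] := fl_op_delta _ _ _ _ f1 f2 E1.
have [fq [d2 h2 /= qE]] := fl_op_delta _ _ _ _ fb fb E2.
have [fz /= hz] := fl_op_eps _ _ _ _ u1 fp_ fq E3.
split=> //.
have k1 : `|a2 * a1 * d1| <= u * `|a2 * a1| by rewrite normrM mulrC ler_wpM2r.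
have k2 : `|b ^+ 2 * d2| <= u * `|b ^+ 2| by rewrite normrM mulrC ler_wpM2r.
have -> : z - (a1 * a2 - b ^+ 2) = (z - (p - q)) + a2 * a1 * d1 - b ^+ 2 * d2.
  by rewrite pE qE; ring.
rewrite (le_trans (ler_normB _ _)) // !mulrDr.
have := ler_normD (z - (p - q)) (a2 * a1 * d1).
lra.
Qed.

Lemma fl_diag_step (a c1 b c2 z : R) :
  0 < u -> 2%:R * u < 1 ->
  fpnum fp a -> fpnum fp c1 -> fpnum fp b -> fpnum fp c2 ->
  fl_eval fp (- (FpNum a * FpNum c1
                 + (FpNum b * FpNum b) * FpNum c2))%fpexpr = Some z ->
  fpnum fp z /\
  `|z - - (a * c1 + b ^+ 2 * c2)| <=
    u * (`|a * c1| + `|z|) + gamma_ 2 u * `|b ^+ 2 * c2|.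
Proof.
move=> u0 u2 fa f1 fb f2 /=.
case E1 : (fl_op fp FpMul a c1) => [p|] //.
case E2 : (fl_op fp FpMul b b) => [q|] //.
case E3 : (fl_op fp FpMul q c2) => [r|] //.
case E4 : (fl_op fp FpAdd p r) => [w|] // [<-].
have [fp_ [d1 h1 /= pE]] := fl_op_delta _ _ _ _ fa f1 E1.
have [fq [d2 h2 /= qE]] := fl_op_delta _ _ _ _ fb fb E2.
have [fr [d3 h3 /= rE]] := fl_op_delta _ _ _ _ fq f2 E3.
have [|fw /= hw] := fl_op_eps _ _ _ _ _ fp_ fr E4; first lra.
split; first exact: hfp.1.
have k1 := rounded_product_error _ u (b ^+ 2 * c2) d2 d3 u0 u2 h2 h3.
have k2 : `|a * c1 * d1| <= u * `|a * c1| by rewrite normrM mulrC ler_wpM2r.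
rewrite -!/(gamma_ 2 u) in k1.
set B1 := (b ^+ 2 * c2 * _ - _) in k1.
have -> : - w - - (a * c1 + b ^+ 2 * c2) = - ((w - (p + r)) + a * c1 * d1 + B1).
  by rewrite pE rE qE /B1; ring.
rewrite !normrN (le_trans (ler_normD _ _)) // !mulrDr.
have := ler_normD (w - (p + r)) (a * c1 * d1).
lra.
Qed.

(** The errors of the preceding coefficients pass through the linear recurrence with weights 1, |a|
    and [b2]; [e] is the local rounding error. A missing coefficient is covered by inserting 0 or 1
    with error 0. *)
Lemma three_term_error (z x1 x2 x3 y1 y2 y3 a b2 e e1 e2 e3 : R) :
  0 <= b2 -> `|z - (x1 - a * x2 - b2 * x3)| <= e ->
  `|x1 - y1| <= e1 -> `|x2 - y2| <= e2 -> `|x3 - y3| <= e3 ->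
  `|z - (y1 - a * y2 - b2 * y3)| <= e1 + `|a| * e2 + b2 * e3 + e.
Proof.
move=> b0 h h1 h2 h3.
have -> : z - (y1 - a * y2 - b2 * y3) =
  (z - (x1 - a * x2 - b2 * x3)) + (x1 - y1) - a * (x2 - y2) - b2 * (x3 - y3).
  by ring.
have k2 : `|a * (x2 - y2)| <= `|a| * e2 by rewrite normrM ler_wpM2l.
have k3 : `|b2 * (x3 - y3)| <= b2 * e3.
  by rewrite normrM (ger0_norm b0) ler_wpM2l.
rewrite (le_trans (ler_normB _ _)) //.
have := ler_normB (z - (x1 - a * x2 - b2 * x3) + (x1 - y1)) (a * (x2 - y2)).
have := ler_normD (z - (x1 - a * x2 - b2 * x3)) (x1 - y1).
lra.
Qed.

Variables (n k : nat) (alpha beta : nat -> R) (chat phi : nat -> nat -> R).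
Hypothesis (u0 : 0 < u) (hnu : n%:R * u < 1).
Hypothesis falpha : forall i, (1 <= i <= n)%N -> fpnum fp (alpha i).
Hypothesis fbeta : forall i, (2 <= i <= n)%N -> fpnum fp (beta i).
Hypothesis hchat : labudde_computed fp n k alpha beta chat.
Hypothesis hphi : running_bounds u n k alpha beta chat phi.

Let c j i := char_coef (symtridiag_mx i alpha beta) j.

(** Strong induction on the superscript, for all subscripts at once, since a step refers to
    superscripts i - 1 and i - 2. Membership in [fpnum] is carried along because the rounding model
    speaks only of floating point operands. *)
Lemma labudde_running_error (i j : nat) : (1 <= j <= k)%N -> (j <= i <= n)%N ->
  fpnum fp (chat j i) /\ `|chat j i - c j i| <= phi j i.
Proof.
(* For n = 1 the hypothesis gives only u < 1, but then only the exact initial value occurs. *)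
have u2 : (2 <= n)%N -> 2%:R * u < 1.
  by move=> n2; rewrite (le_lt_trans _ hnu) // ler_pM2r // ler_nat.
elim/ltn_ind: i j => i IH j hj hi.
have := hchat j i hj hi; rewrite /labudde_expr (hphi j i hj hi) /running_bound_rhs.
have [j1|j1] := eqVneq j 1%N.
  subst j; have [i1|i1] := eqVneq i 1%N.
    subst i => /= -[<-]; rewrite /c char_coef_symtridiag1 subrr normr0; split=> //.
    by apply: hfp.1; apply: falpha; lia.
  have n2 : (2 <= n)%N by lia.
  have ui : u < 1 by have {}u2 := u2 n2; lra.
  case: i IH hi i1 => [|[|i]] //= IH hi _.
  have [|||fc hc] // := IH i.+1 _ 1%N; [lia|].
  move=> E; have [|fz /= hz] := fl_op_eps _ _ _ _ ui fc _ E; first by apply: falpha; lia.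
  split=> //; rewrite /c char_coef_symtridiag_1S -/(c 1%N i.+1).
  have -> : chat 1%N i.+2 - (c 1%N i.+1 - alpha i.+2) =
      (chat 1%N i.+1 - c 1%N i.+1) + (chat 1%N i.+2 - (chat 1%N i.+1 - alpha i.+2)).
    by ring.
  by rewrite (le_trans (ler_normD _ _)) // lerD.
have n2 : (2 <= n)%N by lia.
have {}u2 := u2 n2.
have u1 : u < 1 by lra.
have [j2|j2] := eqVneq j 2%N.
  subst j; have [i2|i2] := eqVneq i 2%N.
    subst i => E; have [|||fz hz] := fl_diag_step2 _ _ _ _ u1 _ _ _ E.
    - by apply: falpha; lia.
    - by apply: falpha; lia.
    - by apply: fbeta; lia.
    split=> //; rewrite /c char_coef_symtridiag_diag.
    rewrite char_coef_symtridiag1 char_coef0 mulr1.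
    rewrite (_ : - (_ + _) = alpha 1%N * alpha 2%N - beta 2%N ^+ 2) //; ring.
  case: i IH hi i2 => [|[|i]] IH hi i2; [lia|lia|].
  have [|||f2 h2] := IH i.+1 _ 2%N; [lia | lia | lia |].
  have [|||f1 h1] := IH i.+1 _ 1%N; [lia | lia | lia |].
  move=> E; have [||fz hz] := fl_cancel_step2 _ _ _ _ _ u0 u2 f2 _ f1 _ E.
  - by apply: falpha; lia.
  - by apply: fbeta; lia.
  split=> //; rewrite /c char_coef_symtridiag_rec; last lia.
  rewrite char_coef0.
  (* The third coefficient is the exact c_0 = 1. *)
  have h0 : `|1 - 1| <= 0 :> R by rewrite subrr normr0.
  rewrite -[X in `|_ - (_ - X)|]mulr1 in hz.
  have := three_term_error _ _ _ _ _ _ _ _ _ _ _ _ _ (sqr_ge0 _) hz h2 h1 h0.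
  by rewrite mulr0 addr0 addrA.
have [ij|ij] := eqVneq i j.
  subst j.
  case: i IH hj hi j1 j2 => [|[|[|i]]] // IH hj hi _ _.
  have [|||f2 h2] := IH i.+2 _ i.+2; [lia | lia | lia |].
  have [|||f1 h1] := IH i.+1 _ i.+1; [lia | lia | lia |].
  move=> E; have [||fz hz] := fl_diag_step _ _ _ _ _ u0 u2 _ f2 _ f1 E.
  - by apply: falpha; lia.
  - by apply: fbeta; lia.
  split=> //; rewrite /c char_coef_symtridiag_diag.
  (* On the diagonal there is no coefficient with subscript i and superscript i - 1; 0 with error 0
     takes its place. *)
  have h0 : `|(0 : R) - 0| <= 0 by rewrite subrr normr0.
  rewrite opprD -[- (alpha _ * _)]sub0r in hz.
  have := three_term_error _ _ _ _ _ _ _ _ _ _ _ _ _ (sqr_ge0 _) hz h0 h2 h1.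
  by rewrite !sub0r !add0r !addrA -opprD.
case: i IH hi ij => [|[|i]] IH hi ij; [lia|lia|].
case: j hj hi j1 j2 ij => [|[|[|j]]] // hj hi _ _ ij.
have [|||f3 h3] := IH i.+1 _ j.+3; [lia | lia | lia |].
have [|||f2 h2] := IH i.+1 _ j.+2; [lia | lia | lia |].
have [|||f1 h1] := IH i _ j.+1; [lia | lia | lia |].
move=> E; have [||fz hz] := fl_cancel_step _ _ _ _ _ _ u0 u2 f3 _ f2 _ f1 E.
- by apply: falpha; lia.
- by apply: fbeta; lia.
split=> //; rewrite /c char_coef_symtridiag_rec; last lia.
have := three_term_error _ _ _ _ _ _ _ _ _ _ _ _ _ (sqr_ge0 _) hz h3 h2 h1.
by rewrite addrA.
Qed.

End RunningError.

(** * Perturbation of the characteristic polynomial *)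

Lemma deriv_prod (R : comNzRingType) (n : nat) (p : 'I_n -> {poly R}) :
  (\prod_i p i)^`() = \sum_i (p i)^`() * \prod_(l | l != i) p l.
Proof.
elim: n p => [|n IH] p; first by rewrite !big_ord0 derivC.
rewrite !big_ord_recl derivM IH; congr (_ * _ + _).
  rewrite [RHS]big_mkcond big_ord_recl eqxx /= mul1r.
  by apply: eq_bigr.
rewrite mulr_sumr; apply: eq_bigr => i _.
rewrite [X in _ = _ * X]big_mkcond big_ord_recl /= mulrCA; congr (_ * (_ * _)).
by rewrite [LHS]big_mkcond; apply: eq_bigr => l _; rewrite (inj_eq lift_inj).
Qed.

Lemma char_poly_conj (R : comUnitRingType) (n : nat) (P M : 'M[R]_n) :
  P \in unitmx -> char_poly (invmx P *m M *m P) = char_poly M.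
Proof.
move=> uP; have hP : map_mx polyC (invmx P) *m map_mx polyC P = 1%:M.
  by rewrite -map_mxM mulVmx // map_mx1.
rewrite /char_poly; have -> : char_poly_mx (invmx P *m M *m P) =
    map_mx polyC (invmx P) *m char_poly_mx M *m map_mx polyC P.
  rewrite /char_poly_mx mulmxBr mulmxBl -!map_mxM; congr (_ - _).
  by rewrite mul_mx_scalar -scalemxAl hP scalemx1.
by rewrite !det_mulmx mulrAC -det_mulmx hP det1 mul1r.
Qed.

(** Expanding the product, the set [I] of factors from which sigma_i is taken contributes to the
    power n - #|I| of X. *)
Lemma elem_sym_coef (R : realType) (n : nat) (sigma : 'I_n -> R) (j : nat) :
  (j <= n)%N -> elem_sym sigma j = (\prod_i ('X + (sigma i)%:P))`_(n - j).
Proof.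
move=> jn; under eq_bigr do rewrite addrC.
rewrite bigA_distr coef_sum /elem_sym big_mkcond; apply: eq_bigr => I _.
rewrite big_if /= big_const iter_mulr_1 -rmorph_prod /= coefCM coefXn.
have : (#|I| + #|(fun i => i \notin I)|)%N = n.
  by rewrite -[RHS]card_ord -(cardC (mem I)).
move: #|I| #|(fun i => i \notin I)| => a b ab.
by case: eqP => h1; case: eqP => h2; rewrite ?mulr1 ?mulr0 //; lia.
Qed.

(** * Coefficientwise majorization of polynomials *)

Section Domination.
Local Set Implicit Arguments.
Local Unset Strict Implicit.
Variable R : numDomainType.
Implicit Types p q : {poly R}.

(** Majorants survive sums and products, so a determinant can be bounded factor by factor. A
    [numDomainType] is general enough for complex coefficients; the inequality forces those of [q]
    to be nonnegative. *)
Definition dominated p q := forall k, `|p`_k| <= q`_k.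

Lemma dominated_ge0 p q k : dominated p q -> 0 <= q`_k.
Proof. by move/(_ k); apply: le_trans. Qed.

Lemma dominatedD p1 p2 q1 q2 :
  dominated p1 q1 -> dominated p2 q2 -> dominated (p1 + p2) (q1 + q2).
Proof. by move=> h1 h2 k; rewrite !coefD (le_trans (ler_normD _ _)) // lerD. Qed.

Lemma dominatedM p1 p2 q1 q2 :
  dominated p1 q1 -> dominated p2 q2 -> dominated (p1 * p2) (q1 * q2).
Proof.
move=> h1 h2 k; rewrite !coefM (le_trans (ler_norm_sum _ _ _)) //.
by apply: ler_sum => i _; rewrite normrM ler_pM.
Qed.

Lemma dominatedN p q : dominated p q -> dominated (- p) q.
Proof. by move=> h k; rewrite coefN normrN. Qed.

Lemma dominatedC (a b : R) : `|a| <= b -> dominated a%:P b%:P.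
Proof. by move=> h k; rewrite !coefC; case: eqP; rewrite ?normr0. Qed.

Lemma dominatedX : dominated 'X 'X.
Proof. by move=> k; rewrite coefX normr_nat. Qed.

Lemma dominated_sum (I : finType) (P : pred I) (p q : I -> {poly R}) :
  (forall i, P i -> dominated (p i) (q i)) ->
  dominated (\sum_(i | P i) p i) (\sum_(i | P i) q i).
Proof.
move=> h; apply: (big_ind2 dominated) => //; first by move=> k; rewrite coef0 normr0.
by move=> *; apply: dominatedD.
Qed.

Lemma dominated_prod (I : finType) (P : pred I) (p q : I -> {poly R}) :
  (forall i, P i -> dominated (p i) (q i)) ->
  dominated (\prod_(i | P i) p i) (\prod_(i | P i) q i).
Proof.
move=> h; apply: (big_ind2 dominated) => //; last by move=> *; apply: dominatedM.
by apply: dominatedC; rewrite normr1.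
Qed.

(** Source of all second order terms: two distinct factors of size [e] yield [e ^+ 2], and the
    remaining ones are bounded uniformly by [q]. *)
Lemma dominated_prod_small2 (I : finType) (p : I -> {poly R}) (q : {poly R})
    (e : R) (i j : I) :
  i != j -> (forall l, dominated (p l) q) ->
  dominated (p i) (e *: q) -> dominated (p j) (e *: q) ->
  dominated (\prod_l p l) (e ^+ 2 *: q ^+ #|I|).
Proof.
move=> ij h hi hj.
have -> : e ^+ 2 *: q ^+ #|I| = e *: q * (e *: q * \prod_(l | (l != i) && (l != j)) q).
  rewrite -[q ^+ #|_|]prodr_const (bigD1 i) //= (bigD1 j) /=; last by rewrite eq_sym.
  by rewrite -!scalerAl -scalerAr scalerA -expr2.
rewrite (bigD1 i) //= (bigD1 j) /=; last by rewrite eq_sym.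
by apply: dominatedM => //; apply: dominatedM => //; apply: dominated_prod.
Qed.

End Domination.

(** Puts a small constant under a multiple of the one majorant X + M that also covers the factors X
    - d_i. *)
Lemma dominated_scale_affine (R : numDomainType) (c e M : R) :
  0 <= e -> `|c| <= e -> 1 <= M -> dominated c%:P (e *: ('X + M%:P)).
Proof.
move=> e0 ce M1 k; rewrite coefC coefZ coefD coefX coefC.
case: k => [|[|k]] /=; rewrite ?normr0 ?add0r ?addr0 ?mulr0 ?mulr1 //.
by rewrite (le_trans ce) // ler_peMr.
Qed.

(* Leibniz expansion: a permutation other than the identity moves at least two
   indices, so that its term has two factors from [F]. *)
Lemma char_poly_diag_perturb (R : numDomainType) (n : nat) (d : 'rV[R]_n)
    (F : 'M[R]_n) (e M : R) :
  0 <= e -> e <= 1 -> 1 <= M -> (forall i j, `|F i j| <= e) ->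
  (forall i, `|d 0 i| + 1 <= M) ->
  dominated (char_poly (diag_mx d + F) - \prod_i ('X - (d 0 i)%:P))
    (e *: (\prod_i ('X + `|d 0 i|%:P))^`() +
     (e ^+ 2 * (#|[pred s : 'S_n | s != 1%g]| +
                #|[pred J : {set 'I_n} | (1 < #|J|)%N]|)%:R) *: ('X + M%:P) ^+ n).
Proof.
move=> e0 e1 M1 hF hd; set q := 'X + M%:P.
have domq c : `|c| <= 1 -> dominated c%:P q.
  by move=> c1; rewrite -[q]scale1r; apply: dominated_scale_affine.
have domXq c : `|c| <= M -> dominated ('X - c%:P) q.
  move=> cM; apply: dominatedD; first exact: dominatedX.
  by apply: dominatedN; apply: dominatedC.
have hS (s : 'S_n) : s != 1%g ->
    dominated ((-1) ^+ s * \prod_i char_poly_mx (diag_mx d + F) i (s i))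
              (e ^+ 2 *: q ^+ n).
  move=> s1.
  have [i si] : exists i, s i != i.
    apply/existsP; rewrite -negb_forall; apply: contra s1 => /forallP h.
    by apply/eqP/permP => i; rewrite perm1; apply/eqP.
  have entryE l : s l != l ->
      char_poly_mx (diag_mx d + F) l (s l) = - (F l (s l))%:P.
    by move=> /negPf h; rewrite !mxE eq_sym h !mulr0n sub0r add0r.
  have hsign p r : dominated p r -> dominated ((-1) ^+ s * p) r.
    move=> h; rewrite -[r]mul1r; apply: dominatedM => //.
    by rewrite -(rmorphN1 polyC) -rmorphXn; apply: dominatedC; rewrite normr_sign.
  apply: hsign; rewrite -[X in q ^+ X]card_ord.
  (* If [s] moves [i], injectivity shows that it moves [s i] too, so both rows contribute an
     off-diagonal entry, that is, one of [F]. *)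
  apply: (@dominated_prod_small2 _ _ _ _ _ i (s i)).
  - by rewrite eq_sym.
  - move=> l; have [sl|sl] := eqVneq (s l) l; last first.
      rewrite entryE //; apply: dominatedN; apply: domq; exact: le_trans (hF _ _) e1.
    rewrite sl !mxE eqxx mulr1n; apply: domXq.
    rewrite (le_trans (ler_normD _ _)) // (le_trans _ (hd l)) // lerD //.
    exact: le_trans (hF _ _) e1.
  - by rewrite entryE //; apply: dominatedN; apply: dominated_scale_affine.
  - rewrite entryE ?(inj_eq perm_inj) //.
    by apply: dominatedN; apply: dominated_scale_affine.
(* [G J] is the term of the expanded diagonal product that takes - F_ii exactly for i in [J]. The
   empty set gives the unperturbed polynomial, singletons the linear part, larger sets second order
   terms. *)
pose G (J : {set 'I_n}) : {poly R} :=
  \prod_i (if i \in J then - (F i i)%:P else 'X - (d 0 i)%:P).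
have hJ (J : {set 'I_n}) : (1 < #|J|)%N -> dominated (G J) (e ^+ 2 *: q ^+ n).
  case/card_gt1P => i [j] [iJ jJ ij].
  rewrite -[X in q ^+ X]card_ord; apply: (@dominated_prod_small2 _ _ _ _ _ i j) => //.
  - move=> l; case: ifP => _.
      by apply: dominatedN; apply: domq; exact: le_trans (hF _ _) e1.
    by apply: domXq; rewrite (le_trans _ (hd l)) // lerDl.
  - by rewrite iJ; apply: dominatedN; apply: dominated_scale_affine.
  - by rewrite jJ; apply: dominatedN; apply: dominated_scale_affine.
have h1 : \prod_i char_poly_mx (diag_mx d + F) i i = \sum_J G J.
  rewrite -(bigA_distr _ _ (fun i => - (F i i)%:P) (fun i => 'X - (d 0 i)%:P)).
  apply: eq_bigr => i _; rewrite !mxE eqxx !mulr1n rmorphD /=; ring.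
have cardJ0 (J : {set 'I_n}) : (#|J| == 0%N) = (J == finset.set0).
  by rewrite cards_eq0.
rewrite /char_poly /determinant (bigD1 1%g) //= odd_perm1 mul1r.
under eq_bigr do rewrite perm1.
rewrite h1 (bigID (fun J : {set 'I_n} => (1 < #|J|)%N)) /=.
rewrite [X in _ + X + _ - _](bigID (fun J : {set 'I_n} => #|J| == 0%N)) /=.
rewrite [X in _ + (X + _) + _ - _](big_pred1 finset.set0); last first.
  by move=> J; rewrite /= -cardJ0; case: (#|J|) => [|[]].
rewrite [X in _ + (_ + X) + _ - _]
  (eq_bigl (fun J : {set 'I_n} => #|J| == 1%N)); last first.
  by move=> J /=; case: (#|J|) => [|[]].
rewrite big_cards1.
have -> : G finset.set0 = \prod_i ('X - (d 0 i)%:P).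
  by apply: eq_bigr => i _; rewrite inE.
set S2 := (\sum_(J | _) _); set S1 := (\sum_i G _); set S0 := (\sum_(s | _) _).
rewrite (_ : _ - _ = S1 + (S0 + S2)); last by ring.
apply: dominatedD.
  rewrite deriv_prod scaler_sumr; apply: dominated_sum => i _.
  rewrite derivD derivX derivC addr0 mul1r -mul_polyC.
  rewrite /G (bigD1 i) //= inE eqxx; apply: dominatedM.
    by apply: dominatedN; apply: dominatedC.
  apply: dominated_prod => l li; rewrite inE (negPf li).
  apply: dominatedD; first exact: dominatedX.
  by apply: dominatedN; apply: dominatedC.
(* The numeric factor counts the second order terms: non-identity permutations and sets with at
   least two elements. *)
rewrite natrD mulrDr scalerDl !mulr_natr -!scalerMnl -!sumr_const.
by apply: dominatedD; apply: dominated_sum.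
Qed.

(** * Unitary conjugation and spectrum over the complex numbers *)

(** The sum of the squared moduli is the trace of M times its conjugate transpose, which unitary
    conjugation preserves; a single entry is at most the whole sum. *)
Lemma unitary_conj_entry (C : numClosedFieldType) (n : nat) (W E : 'M[C]_n)
    (i j : 'I_n) :
  W \is unitarymx ->
  `|(W *m E *m (W ^t* )%sesqui) i j| ^+ 2 <= \sum_k \sum_l `|E k l| ^+ 2.
Proof.
move=> uW.
have normE (M : 'M[C]_n) :
    \sum_k \sum_l `|M k l| ^+ 2 = \tr (M *m (M ^t* )%sesqui).
  apply: eq_bigr => k _; rewrite !mxE; apply: eq_bigr => l _.
  by rewrite !mxE normCK.
have -> : \sum_k \sum_l `|E k l| ^+ 2 =
    \sum_k \sum_l `|(W *m E *m (W ^t* )%sesqui) k l| ^+ 2.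
  rewrite !normE !trmx_mul !map_mxM map_trmx trmxK -map_mx_comp.
  rewrite (map_mx_id (@conjCK _)) !mulmxA (mulmxKtV _ uW) //.
  by rewrite -!mulmxA [RHS]mxtrace_mulC !mulmxA (mulmxKtV _ uW).
rewrite (bigD1 i) //= (bigD1 j) //= -addrA lerDl addr_ge0 //.
  by apply: sumr_ge0 => l _; rewrite exprn_ge0.
by apply: sumr_ge0 => k _; apply: sumr_ge0 => l _; rewrite exprn_ge0.
Qed.

Section ComplexSpectrum.
Variable R : realType.
Local Notation toC := (real_complex R).

Lemma conj_real_mx (m n : nat) (M : 'M[R]_(m, n)) :
  ((map_mx toC M) ^t* )%sesqui = map_mx toC M^T.
Proof.
by apply/matrixP => i j; rewrite !mxE conj_Creal // complex_real.
Qed.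

(** A real symmetric matrix equals its conjugate transpose over [R[i]], so it is normal and the
    spectral theorem applies. *)
Lemma symmetric_spectral (n : nat) (A : 'M[R]_n) : symmetric_mx A ->
  exists P : 'M[R[i]]_n, exists2 d : 'rV[R[i]]_n, P \is unitarymx &
    map_mx toC A = invmx P *m diag_mx d *m P.
Proof.
move=> hA; exists (spectralmx (map_mx toC A)), (spectral_diag (map_mx toC A)).
  exact: spectral_unitarymx.
by apply/orthomx_spectralP; apply/normalmxP; rewrite conj_real_mx hA.
Qed.

(** The matrix [A^T *m A] is unitarily similar to the diagonal matrix of the |d_i|^2. Comparing
    roots of its characteristic polynomial and taking square roots gives equality as multisets,
    enough for symmetric functions. *)
Lemma singular_values_spectral (n : nat) (A : 'M[R]_n) (sigma : 'I_n -> R)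
    (P : 'M[R[i]]_n) (d : 'rV[R[i]]_n) :
  singular_values A sigma -> P \is unitarymx ->
  map_mx toC A = invmx P *m diag_mx d *m P ->
  perm_eq [seq `|d 0 i| | i <- enum 'I_n] [seq toC (sigma i) | i <- enum 'I_n].
Proof.
move=> [s0 _ hs] uP hA.
have : char_poly (map_mx toC (A^T *m A)) = \prod_i ('X - (`|d 0 i| ^+ 2)%:P).
  rewrite map_mxM -conj_real_mx hA !trmx_mul !map_mxM (invmx_unitary uP).
  rewrite map_trmx trmxK -map_mx_comp (map_mx_id (@conjCK _)).
  rewrite tr_diag_mx map_diag_mx !mulmxA (mulmxtVK _ uP).
  rewrite -invmx_unitary // -[_ *m diag_mx _ *m diag_mx _]mulmxA mulmx_diag.
  rewrite char_poly_conj ?unitarymx_unit // char_poly_trig ?diag_mx_is_trig //.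
  by apply: eq_bigr => i _; rewrite !mxE eqxx mulr1n normCK mulrC.
rewrite -map_char_poly hs rmorph_prod /=.
have -> : \prod_(i < n) map_poly toC ('X - (sigma i ^+ 2)%:P) =
    \prod_(i < n) ('X - (toC (sigma i) ^+ 2)%:P).
  apply: eq_bigr => i _; rewrite rmorphB /= map_polyX map_polyC.
  by congr (_ - _%:P); apply: rmorphXn.
have prodE (g : 'I_n -> R[i]) : \prod_i ('X - (g i)%:P) =
    \prod_(x <- [seq g i | i <- enum 'I_n]) ('X - x%:P).
  by rewrite big_map big_enum.
rewrite (prodE (fun i => toC (sigma i) ^+ 2)) (prodE (fun i => `|d 0 i| ^+ 2)).
move=> /prod_XsubC_eq; rewrite perm_sym => /(perm_map sqrtC); rewrite -!map_comp.
rewrite (@eq_map _ _ _ (fun i => `|d 0 i|)); last by move=> i /=; rewrite sqrCK.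
rewrite (@eq_map _ _ (_ \o (fun i => toC (sigma i) ^+ 2)) (fun i => toC (sigma i))) //.
by move=> i /=; rewrite sqrCK // ler0c.
Qed.

Lemma norm_real_complex (x : R) :
  `|toC x| = toC `|x|.
Proof. by rewrite normc_def /= expr0n addr0 sqrtr_sqr. Qed.

(** [K] is fixed before [T], [E], [e] and [j]; this uniformity lets a single remainder function
    serve all computations. *)
Lemma char_coef_perturb (n : nat) (A : 'M[R]_n)
    (sigma : 'I_n -> R) : symmetric_mx A -> singular_values A sigma ->
  exists2 K : R, 0 <= K &
    forall (T E : 'M[R]_n) (e : R) (j : nat),
      orthogonally_similar A T -> frobenius_norm E <= e -> e <= 1 ->
      (1 <= j <= n)%N ->
      `|char_coef (T + E) j - char_coef A j| <=
        (n - j + 1)%:R * elem_sym sigma j.-1 * e + K * e ^+ 2.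
Proof.
move=> hA hs; have [P [d uP hAd]] := symmetric_spectral _ _ hA.
have hperm := singular_values_spectral _ _ _ _ _ hs uP hAd.
have s0 i : 0 <= sigma i by case: hs.
(* Each |d_i| is one of the singular values, so [M] bounds |d_i| + 1. *)
pose M := 1 + \sum_i sigma i.
have M1 : 1 <= M by rewrite lerDl sumr_ge0.
pose N : R := (#|[pred s : 'S_n | s != 1%g]| +
               #|[pred J : {set 'I_n} | (1 < #|J|)%N]|)%:R.
(* The sum of all coefficients of the majorant bounds each of them, independently of [j]. *)
pose B := \sum_(k < n.+1) (('X + M%:P) ^+ n)`_k.
have B0 k : 0 <= (('X + M%:P) ^+ n)`_k.
  have dom1 : dominated ('X + M%:P) ('X + M%:P).
    by apply: dominatedD; [exact: dominatedX | apply: dominatedC; rewrite ger0_norm; lra].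
  have := @dominated_prod _ 'I_n xpredT _ _ (fun _ _ => dom1).
  by rewrite prodr_const card_ord => /dominated_ge0.
have N0 : 0 <= N by rewrite ler0n.
exists (N * B); first by rewrite mulr_ge0 // sumr_ge0.
move=> T E e j [Q hQ ->] hE e1 hj.
have e0 : 0 <= e by rewrite (le_trans _ hE) // sqrtr_ge0.
(* [W] diagonalizes [T] and turns [E] into [F], while the diagonal [d] remains that of [A]. *)
have [W WE] : exists W, W = P *m map_mx toC Q by exists (P *m map_mx toC Q).
have uQ : map_mx toC Q \is unitarymx.
  by apply/unitarymxP; rewrite conj_real_mx -map_mxM (mulmx1C hQ) map_mx1.
have uW : W \is unitarymx by rewrite WE mul_unitarymx.
pose F := W *m map_mx toC E *m (W ^t* )%sesqui.
have hF i l : `|F i l| <= toC e.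
  rewrite -(@ler_pXn2r _ 2) ?nnegrE ?normr_ge0 ?ler0c //.
  apply: le_trans (unitary_conj_entry _ _ _ _ i l uW) _.
  have -> : \sum_k \sum_l0 `|(map_mx toC E) k l0| ^+ 2 = toC (frobenius_norm E ^+ 2).
    rewrite sqr_sqrtr; last by do 2!apply: sumr_ge0 => ? _; rewrite sqr_ge0.
    rewrite rmorph_sum; apply: eq_bigr => k _; rewrite rmorph_sum.
    apply: eq_bigr => k' _; rewrite !mxE norm_real_complex -rmorphXn /=.
    by rewrite real_normK // num_real.
  by rewrite -rmorphXn lecR ler_pXn2r ?nnegrE // sqrtr_ge0.
have hT : map_mx toC (Q^T *m A *m Q + E) = invmx W *m (diag_mx d + F) *m W.
  rewrite mulmxDr mulmxDl map_mxD; congr (_ + _).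
    rewrite !map_mxM hAd (invmx_unitary uW) WE (invmx_unitary uP) trmx_mul map_mxM.
    by rewrite conj_real_mx !mulmxA.
  rewrite /F (invmx_unitary uW) !mulmxA.
  have WW : (W ^t* )%sesqui *m W = 1%:M.
    by rewrite -invmx_unitary // mulVmx // unitarymx_unit.
  by rewrite WW mul1mx -mulmxA WW mulmx1.
have coefE (L : 'M[R]_n) : toC (char_coef L j) = (char_poly (map_mx toC L))`_(n - j).
  by rewrite -map_char_poly coef_map.
have hD : char_poly (map_mx toC A) = \prod_i ('X - (d 0 i)%:P).
  rewrite hAd char_poly_conj ?unitarymx_unit // char_poly_trig ?diag_mx_is_trig //.
  by apply: eq_bigr => i _; rewrite !mxE eqxx mulr1n.
have hd i : exists l, `|d 0 i| = toC (sigma l).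
  have : `|d 0 i| \in [seq `|d 0 i| | i <- enum 'I_n].
    by apply: map_f; rewrite mem_enum.
  by rewrite (perm_mem hperm) => /mapP[l _ ->]; exists l.
have hprod : \prod_i ('X + `|d 0 i|%:P) = map_poly toC (\prod_i ('X + (sigma i)%:P)).
  have prodE (g : 'I_n -> R[i]) : \prod_i ('X + (g i)%:P) =
      \prod_(x <- [seq g i | i <- enum 'I_n]) ('X + x%:P).
    by rewrite big_map big_enum.
  rewrite prodE (perm_big _ hperm) -(prodE (fun i => toC (sigma i))) rmorph_prod.
  by apply: eq_bigr => i _; rewrite rmorphD /= map_polyX map_polyC.
have hdM i : `|d 0 i| + 1 <= toC M.
  have [l ->] := hd i; rewrite -(rmorph1 toC) -rmorphD lecR addrC lerD2l.
  by rewrite (bigD1 l) //= lerDl sumr_ge0.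
have := char_poly_diag_perturb _ _ d F (toC e) (toC M).
rewrite -(rmorph1 toC) ler0c !lecR => /(_ e0 e1 M1 hF); rewrite rmorph1.
move=> /(_ hdM (n - j)%N).
rewrite hprod deriv_map coefB -hD [X in _ <= X -> _]coefD !coefZ coef_map.
have -> : char_poly (diag_mx d + F) = char_poly (map_mx toC (Q^T *m A *m Q + E)).
  by rewrite hT char_poly_conj ?unitarymx_unit.
rewrite -!coefE.
have -> : 'X + (toC M)%:P = map_poly toC ('X + M%:P).
  by rewrite [RHS]rmorphD /= map_polyX map_polyC.
rewrite -!rmorphXn coef_map /= -(rmorph_nat toC) -/N -!rmorphM -rmorphD -rmorphB.
rewrite norm_real_complex lecR => /le_trans; apply.
have jn : (j.-1 <= n)%N by lia.
(* The coefficient of X^(n-j) in the derivative is n - j + 1 times that of X^(n-(j-1)), which is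
   s_(j-1). *)
rewrite coef_deriv (elem_sym_coef _ _ _ _ jn).
have -> : (n - j.-1 = (n - j).+1)%N by lia.
rewrite lerD //; first by rewrite addn1 mulrC mulr_natl.
rewrite [leRHS]mulrC [leRHS]mulrA ler_wpM2l ?mulr_ge0 ?sqr_ge0 //.
have ltn : (n - j < n.+1)%N by lia.
by rewrite /B (bigD1 (Ordinal ltn)) //= lerDl sumr_ge0.
Qed.

End ComplexSpectrum.

(** * Combination of the rounding and perturbation bounds *)

Theorem theorem6p1 (R : realType) (n : nat) (A : 'M[R]_n) (sigma : 'I_n -> R)
    (nu1 : R) (hA : symmetric_mx A) (hsigma : singular_values A sigma)
    (hnu1 : 0 < nu1) :
  exists2 rem : R -> R,
    rem =O_ (at_right (0 : R)) (fun u : R => u ^+ 2) &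
    forall (u : R) (fp : fparith R) (k : nat) (T E : 'M[R]_n)
           (alpha beta : nat -> R) (chat phi : nat -> nat -> R),
      0 < u -> n%:R * u < 1 ->
      fp_model u fp ->
      (1 <= k <= n)%N ->
      symmetric_mx T -> tridiagonal_mx T -> orthogonally_similar A T ->
      T + E = symtridiag_mx n alpha beta ->
      frobenius_norm E <= nu1 * n%:R ^+ 2 * frobenius_norm A * u ->
      frobenius_norm A < 1 / (nu1 * n%:R ^+ 2 * u) ->
      (forall i j : 'I_n, fpnum fp (A i j)) ->
      (forall i j : 'I_n, fpnum fp ((T + E) i j)) ->
      labudde_computed fp n k alpha beta chat ->
      running_bounds u n k alpha beta chat phi ->
      forall j : nat, (1 <= j <= k)%N ->
        `|chat j n - char_coef A j| <=
          (n - j + 1)%:R * elem_sym sigma j.-1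
            * (nu1 * n%:R ^+ 2 * frobenius_norm A * u)
          + phi j n + rem u.
Proof.
have [K K0 hK] := char_coef_perturb _ _ _ _ hA hsigma.
pose c := K * (nu1 * n%:R ^+ 2 * frobenius_norm A) ^+ 2.
have c0 : 0 <= c by rewrite mulr_ge0 // sqr_ge0.
exists (fun u => c * u ^+ 2).
  (* The constant must be positive, whereas [c] may be 0. *)
  apply/eqO_exP; exists (c + 1); first by rewrite ltr_wpDl.
  by apply: filterE => u; rewrite normrM (ger0_norm c0) ler_wpM2r // lerDl.
move=> u fp k T E alpha beta chat phi u0 nu hfp hk _ _ hT TE hE hu _ hfpTE hc hphi j hj.
have n0 : (0 < n)%N by lia.
have fa i : (1 <= i <= n)%N -> fpnum fp (alpha i).
  case: i => // i /= hi; have := hfpTE (Ordinal hi) (Ordinal hi).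
  by rewrite TE !mxE eqxx.
have fb i : (2 <= i <= n)%N -> fpnum fp (beta i).
  case: i => [|[|i]] // hi; have i1 : (i.+1 < n)%N by lia.
  have := hfpTE (Ordinal (ltnW i1)) (Ordinal i1).
  by rewrite TE !mxE -val_eqE /= ltn_eqF // eqxx.
have hjn : (j <= n <= n)%N by lia.
have [_ h1] := labudde_running_error R u fp hfp n k alpha beta chat phi
  u0 nu fa fb hc hphi n j hj hjn.
have den : 0 < nu1 * n%:R ^+ 2 * u by rewrite !mulr_gt0 ?ltr0n.
(* The upper bound on the norm of [A] is what makes the perturbation size at most 1. *)
have e1 : nu1 * n%:R ^+ 2 * frobenius_norm A * u <= 1.
  by move: hu; rewrite ltr_pdivlMr // mulrA [frobenius_norm A * _]mulrC => /ltW.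
have j1n : (1 <= j <= n)%N by lia.
have h2 := hK T E _ j hT hE e1 j1n.
have -> : chat j n - char_coef A j =
  (char_coef (T + E) j - char_coef A j) + (chat j n - char_coef (T + E) j) by ring.
rewrite (le_trans (ler_normD _ _)) // {2}TE.
have -> : c * u ^+ 2 = K * (nu1 * n%:R ^+ 2 * frobenius_norm A * u) ^+ 2.
  by rewrite /c; ring.
lra.
Qed.
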